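(* Let $c \ge 1$ and $k > 1$ be integers, and consider the two-player $(c,k)$-nacci Zeckendorf game starting from $n$ copies of $S_1 = 1$, where $n$ is a positive integer. If the player with the winning strategy makes a mistake as early as turn $c+1$, the opposing player can steal the winning strategy. That is, let $X$ be the player who has a winning strategy from the initial position and let $Y$ be the opposing player. Then $X$ can make a mistake as early as turn $c+1$ that lets $Y$ steal the winning strategy: there is a legal sequence of moves for turns $1, 2, \dots, c+1$ in which turn $c+1$ is taken by $X$, such that $X$ has a winning strategy from the position immediately before turn $c+1$, while $Y$ has a winning strategy from the position immediately after turn $c+1$.
   Context: For integers $c, k \ge 1$, the $(c,k)$-nacci numbers are defined by $S_1 = 1$; $S_{i+1} = cS_i + cS_{i-1} + \cdots + cS_1 + 1$ for $1 \le i \le k$; and $S_{i+1} = cS_i + cS_{i-1} + \cdots + cS_{i-k}$ for $i \ge k+1$. The two-player $(c,k)$-nacci Zeckendorf game on $n$: a position is a finite unordered list (multiset) of $(c,k)$-nacci numbers; the initial position consists of $n$ copies of $S_1$. Players $1$ and $2$ alternate turns, Player $1$ taking turn $1$. Here $aS_i$ denotes $a$ copies of $S_i$. On each turn the player whose turn it is makes one of the following moves, provided the terms on the left are present in the list with at least the indicated multiplicities; they are removed and replaced by the terms on the right: 1. $cS_{i-k} \wedge cS_{i-k+1} \wedge \cdots \wedge cS_i \to S_{i+1}$, for $i \ge k+1$; 2. $(c+1)S_1 \wedge cS_2 \wedge \cdots \wedge cS_i \to S_{i+1}$, for $1 \le i \le k$; 3. (a) $(c+1)S_1 \to S_2$;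 (b) $(c+1)S_i \to S_{i+1}$ for $1 < i < k+1$; (c) $(c+1)S_{k+1} \to S_{k+2} \wedge S_1$; (d) $(c+1)S_i \to S_{i+1} \wedge cS_{i-k-1}$ for $i > k+1$. The game ends when no move is available, and the player who made the final move wins. A player has a winning strategy (from a given position with a given player to move) if that player can guarantee making the final move whatever the opponent does.
   Formalization: The claim fails for some small n (e.g. n = c+1, or c=1, k=2, n=6), so instead of every positive n it is proved when n ≥ (c+1)^3, or when n ≥ (c+1)^2 and turn c+1 is taken by the player X with the winning strategy; exactly the n where the claim fails are excluded. *)

(* Defs.v *)
From mathcomp Require Import all_boot finmap multiset.

Set Implicit Arguments.
Unset Strict Implicit.
Unset Printing Implicit Defensive.

(* The first m (c,k)-nacci numbers, latest first: [:: S_m; ...; S_2; S_1]. *)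
Fixpoint nacci_seq (c k m : nat) : seq nat :=
  if m is i.+1 then
    let s := nacci_seq c k i in
    (if i <= k then c * sumn s + 1 else c * sumn (take k.+1 s)) :: s
  else [::].

(* Numbering starts at 1, as in S_1 = 1; the value at index 0 is junk and no
   rule of the game refers to it. *)
Definition nacci (c k i : nat) : nat := head 0 (nacci_seq c k i).

Lemma take_nacci_seq c k l i :
  l <= i -> sumn (take l (nacci_seq c k i)) = \sum_((i - l).+1 <= j < i.+1) nacci c k j.
Proof.
elim: l i => [|l IHl] [|i] //.
- by rewrite take0 subn0 big_geq.
- by rewrite take0 subn0 big_geq.
move=> le_li; rewrite subSS big_nat_recr /=; last by rewrite ltnS leq_subr.
by rewrite -IHl // addnC.
Qed.

Lemma size_nacci_seq c k i : size (nacci_seq c k i) = i.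
Proof. by elim: i => //= i ->. Qed.

Lemma nacci1 c k : nacci c k 1 = 1.
Proof. by rewrite /nacci /= muln0. Qed.

Lemma nacci_small c k i : 1 <= i <= k ->
  nacci c k i.+1 = c * (\sum_(1 <= j < i.+1) nacci c k j) + 1.
Proof.
case/andP=> _ le_ik; rewrite {1}/nacci /= le_ik.
rewrite -[nacci_seq c k i]take_size size_nacci_seq.
by rewrite take_nacci_seq // subnn.
Qed.

Lemma nacci_large c k i : k.+1 <= i ->
  nacci c k i.+1 = c * \sum_(i - k <= j < i.+1) nacci c k j.
Proof.
move=> lt_ki; rewrite {1}/nacci /= leqNgt lt_ki /=.
by rewrite take_nacci_seq // subnSK.
Qed.

Definition position : Type := {mset nat}%mset.

(* [copies c k a i] is "a S_i". *)
Definition copies (c k a i : nat) : position := msetn a (nacci c k i).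

Definition start (c k n : nat) : position := copies c k n 1.

(* [rule c k l r]: the terms l may be replaced by the terms r. *)
Inductive rule (c k : nat) : position -> position -> Prop :=
| rule_1 i : k.+1 <= i ->
    rule c k (\big[msetD/mset0]_(i - k <= j < i.+1) copies c k c j)
             (copies c k 1 i.+1)
| rule_2 i : 1 <= i <= k ->
    rule c k (msetD (copies c k c.+1 1)
                    (\big[msetD/mset0]_(2 <= j < i.+1) copies c k c j))
             (copies c k 1 i.+1)
| rule_3a :
    rule c k (copies c k c.+1 1) (copies c k 1 2)
| rule_3b i : 1 < i < k.+1 ->
    rule c k (copies c k c.+1 i) (copies c k 1 i.+1)
| rule_3c :
    rule c k (copies c k c.+1 k.+1)
             (msetD (copies c k 1 k.+2) (copies c k 1 1))
| rule_3d i : k.+1 < i ->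
    rule c k (copies c k c.+1 i)
             (msetD (copies c k 1 i.+1) (copies c k c (i - k - 1))).

Definition move (c k : nat) (p q : position) : Prop :=
  exists l r : position,
    [/\ rule c k l r, msubset l p & q = msetD (msetB p l) r].

Inductive player : Type := Player1 | Player2.

Definition opponent (X : player) : player :=
  if X is Player1 then Player2 else Player1.

Definition turn_player (t : nat) : player := if odd t then Player1 else Player2.

(* [wins c k X p P]: from position p with player P to move, X can guarantee
   making the final move.  A derivation is a strategy tree for X: one move at
   each position where X is to move, an answer to every move of the opponent,
   and (the type being inductive) only finite plays.  Its leaves are the
   positions without moves at which the opponent is to move, so that X has
   just made the final move. *)
Inductive wins (c k : nat) (X : player) : position -> player -> Prop :=
| wins_own p q :
    move c k p q -> wins c k X q (opponent X) -> wins c k X p X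
| wins_reply p :
    (forall q, move c k p q -> wins c k X q X) -> wins c k X p (opponent X).

(* Main.v *)
Require Import Defs.
From mathcomp Require Import all_boot.
From mathcomp Require Import finmap multiset zify.

Set Implicit Arguments.
Unset Strict Implicit.
Unset Printing Implicit Defensive.

(** Early in the game only S_1, S_2, S_3 and S_4 occur.  Write (j, i) for the
    position with j copies of S_2, i copies of S_3 and all remaining value in
    copies of S_1.

    The first c turns are forced: they turn c + 1 copies of S_1 into S_2 and
    lead to (c, 0).  There the mover has two options, (c + 1, 0) and (0, 1),
    and the first of them has a move to the second.  Hence, if the mover X
    wins at (c, 0), exactly one option is lost for the player who faces it,
    and X errs by choosing the other one (exists_mistake).

    It remains to see that, for n >= (c + 1)^3, turn c + 1 belongs to the
    winner.  In row i <= c the moves from (0, i) to (c, i) are forced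
    (wins_along_row).  Passing to the next row also flips who wins: the
    position (0, i + 1) is lost for its mover exactly when (c, i) is won for
    its mover (wins_next_row).  If (c, i) is lost, this is clear, as (0, i + 1)
    is one of its options.  If (c, i) is won but (0, i + 1) were not lost, the
    mover at (c, i) would win through (c + 1, i), so both options (0, i + 1)
    and (1, i + 1) of the latter would be won for their mover; but (1, i + 1)
    is the only option of (0, i + 1), a contradiction.

    So the outcome of (c, c) is that of (c, 0) flipped c (c + 1) times, an
    even number: the two agree.  Finally (c, c) cannot be lost for its mover
    (corner_not_lost), by the same kind of argument with S_4 in place of S_3
    as the term that can be created in two ways. *)

(** * Winning positions *)

Lemma opponentK X : opponent (opponent X) = X.
Proof. by case: X. Qed.

Lemma opponent_neq X : opponent X <> X.
Proof. by case: X. Qed.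

Lemma player_cases X P : P = X \/ P = opponent X.
Proof. by case: X; case: P; [left | right | right | left]. Qed.

Lemma iter_opponent t P : iter t opponent P = if odd t then opponent P else P.
Proof. by elim: t => //= t ->; case: (odd t); rewrite /= ?opponentK. Qed.

Lemma turn_player_succ t : turn_player t.+1 = iter t opponent Player1.
Proof. by rewrite iter_opponent /turn_player /=; case: (odd t). Qed.

Lemma wins_to_move c k X p :
  wins c k X p X -> exists2 q, move c k p q & wins c k X q (opponent X).
Proof.
move=> H; inversion H as [p' q Hm Hq | p' Hq Hp HX]; first by exists q.
by case: (opponent_neq HX).
Qed.

Lemma wins_waiting c k X p :
  wins c k X p (opponent X) -> forall q, move c k p q -> wins c k X q X.
Proof.
move=> H; inversion H as [p' q Hm Hq Hp HX | p' Hq] => //.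
by case: (@opponent_neq X).
Qed.

(** By induction on the strategy tree: following one player's winning move
    through the other player's answer keeps both claims alive, and the tree is
    well founded. *)
Lemma wins_exclusive c k X p P : wins c k X p P -> ~ wins c k X p (opponent P).
Proof.
elim=> {p P} [p q Hm _ IH /wins_waiting H | p _ IH].
  by apply: IH; rewrite opponentK; apply: H.
rewrite opponentK => /wins_to_move [q Hm]; exact: IH Hm.
Qed.

(** The rules are impartial, so the two players can exchange their roles. *)
Lemma wins_swap c k X p P :
  wins c k X p P -> wins c k (opponent X) p (opponent P).
Proof.
elim=> {p P} [p q Hm _ | p _ IH]; first exact: wins_own Hm.
exact: wins_reply.
Qed.

Lemma wins_forced c k X p q P :
    move c k p q -> (forall q', move c k p q' -> q' = q) ->
  wins c k X p P -> wins c k X q (opponent P).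
Proof.
move=> Hm Hq; case: (player_cases X P) => -> H.
  by have [q' /Hq ->] := wins_to_move H.
by rewrite opponentK; apply: wins_waiting H _ Hm.
Qed.

(** * Multiplicities of the (c,k)-nacci numbers *)

Lemma nacci_gt0 c k i : 0 < c -> 0 < nacci c k i.+1.
Proof.
move=> c_gt0; elim: i => [|i IHi]; first by rewrite nacci1.
have [le_ik|lt_ki] := leqP i.+1 k; first by rewrite nacci_small // addn1.
rewrite nacci_large // muln_gt0 c_gt0 big_nat_recr /=; last exact: leq_subr.
by rewrite addn_gt0 IHi orbT.
Qed.

Lemma nacci_ltS c k i : 0 < c -> 0 < k -> nacci c k i < nacci c k i.+1.
Proof.
move=> c_gt0 k_gt0; case: i => [|i]; first exact: nacci_gt0.
have [le_ik|lt_ki] := leqP i.+1 k.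
  rewrite (@nacci_small _ _ i.+1) // big_nat_recr //= addn1 ltnS.
  by apply: leq_trans (leq_pmull _ c_gt0); apply: leq_addl.
rewrite (@nacci_large _ _ i.+1) // big_nat_recr /=; last exact: leq_subr.
apply: leq_trans (leq_pmull _ c_gt0); rewrite -[ltnLHS]add0n ltn_add2r.
case: i lt_ki => [|i] lt_ki; first by rewrite ltnS leqNgt k_gt0 in lt_ki.
rewrite big_nat_recr /=; last by rewrite leq_subLR; lia.
by rewrite addn_gt0 nacci_gt0 // orbT.
Qed.

(** Terms of a position are numbers, not indices; injectivity lets
    multiplicities be read off index by index. *)
Lemma nacci_inj c k : 0 < c -> 0 < k -> injective (nacci c k).
Proof.
move=> c_gt0 k_gt0 i j eq_ij.
have lt_nacci: {homo nacci c k : i j / i < j}.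
  by apply: homo_ltn => [? ? ?|{eq_ij}i]; [apply: ltn_trans | apply: nacci_ltS].
by case: (ltngtP i j) => // /lt_nacci; rewrite eq_ij ltnn.
Qed.

Lemma copiesE c k a i y : 0 < c -> 0 < k ->
  copies c k a i (nacci c k y) = if y == i then a else 0.
Proof. by move=> c_gt0 k_gt0; rewrite msetnE (inj_eq (nacci_inj c_gt0 k_gt0)). Qed.

Lemma block_copiesE c k lo hi y : 0 < c -> 0 < k ->
  (\big[msetD/mset0]_(lo <= j < hi) copies c k c j)%mset (nacci c k y)
    = if lo <= y < hi then c else 0.
Proof.
move=> c_gt0 k_gt0.
rewrite (big_morph (fun A : position => A (nacci c k y)) (id1 := 0) (op1 := addn));
  [|by move=> A B; rewrite msetE2|exact: mset0E].
by under eq_bigr do rewrite copiesE // eq_sym; rewrite -big_mkcond big_nat1_eq.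
Qed.

(** * Positions made of the first four numbers *)

Definition stack c k m j i h : position :=
  (copies c k m 1 `+` copies c k j 2 `+` copies c k i 3 `+` copies c k h 4)%mset.

Lemma stackE c k m j i h y : 0 < c -> 0 < k ->
  stack c k m j i h (nacci c k y) =
    if y == 1 then m else if y == 2 then j else if y == 3 then i
    else if y == 4 then h else 0.
Proof.
move=> c_gt0 k_gt0; rewrite !msetE2 !copiesE //.
by case: y => [|[|[|[|[]]]]] //=; lia.
Qed.

(** The identities below hold whether or not the numbers S_1, ..., S_4 are
    distinct, so each comparison of a number with one of them can be split
    independently, leaving linear arithmetic. *)
Ltac by_multiplicities :=
  apply/msetP => ?; rewrite /stack /copies !(msetE2, msetnE); do !case: ifP => _; lia.

Lemma start_stack c k n : start c k n = stack c k n 0 0 0.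
Proof. by_multiplicities. Qed.

Lemma copies_stack c k a :
  (copies c k a 1 = stack c k a 0 0 0) * (copies c k a 2 = stack c k 0 a 0 0) *
  (copies c k a 3 = stack c k 0 0 a 0) * (copies c k a 4 = stack c k 0 0 0 a).
Proof. by do !split; by_multiplicities. Qed.

(** The two rules with a left or right side of mixed terms are put in stack
    form by these lemmas rather than by [stackD], whose left-hand side would
    have to be unified with whole positions. *)
Lemma copies_stack12 c k a b :
  (copies c k a 1 `+` copies c k b 2)%mset = stack c k a b 0 0.
Proof. by_multiplicities. Qed.

Lemma copies_stack41 c k a b :
  (copies c k a 4 `+` copies c k b 1)%mset = stack c k b 0 0 a.
Proof. by_multiplicities. Qed.

Lemma stackD c k m j i h m' j' i' h' :
  (stack c k m j i h `+` stack c k m' j' i' h')%mset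
    = stack c k (m + m') (j + j') (i + i') (h + h').
Proof. by_multiplicities. Qed.

Lemma stack_replace c k m j i h l1 l2 l3 l4 r1 r2 r3 r4 m' j' i' h' :
    l1 <= m -> l2 <= j -> l3 <= i -> l4 <= h ->
    m - l1 + r1 = m' -> j - l2 + r2 = j' -> i - l3 + r3 = i' -> h - l4 + r4 = h' ->
  (stack c k m j i h `\` stack c k l1 l2 l3 l4 `+` stack c k r1 r2 r3 r4)%mset
    = stack c k m' j' i' h'.
Proof. by move=> *; subst; by_multiplicities. Qed.

Lemma move_context c k s l r :
  rule c k l r -> move c k (s `+` l)%mset (s `+` r)%mset.
Proof.
move=> lr; exists l, r; split=> //.
  by apply/msubsetP => x; rewrite msetE2 leq_addl.
by apply/msetP => x; rewrite !msetE2 addnK.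
Qed.

Lemma stack_move c k m j i h l1 l2 l3 l4 r1 r2 r3 r4 :
    rule c k (stack c k l1 l2 l3 l4) (stack c k r1 r2 r3 r4) ->
  move c k (stack c k (m + l1) (j + l2) (i + l3) (h + l4))
           (stack c k (m + r1) (j + r2) (i + r3) (h + r4)).
Proof. by move/(move_context (stack c k m j i h)); rewrite !stackD. Qed.

(** * Moves in the early game *)

Section Moves.
Variables (c k : nat) (c_gt0 : 0 < c) (k_gt1 : 1 < k).
Let k_gt0 : 0 < k. Proof. exact: ltnW. Qed.
Local Notation stack := (stack c k).
Local Notation move := (move c k).

Lemma move_raise1 m j i h : move (stack (m + c.+1) j i h) (stack m j.+1 i h).
Proof.
have := @rule_3a c k; rewrite !copies_stack => /(@stack_move _ _ m j i h).
by rewrite !(addn0, addn1).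
Qed.

Lemma move_merge12 m j i h :
  move (stack (m + c.+1) (j + c) i h) (stack m j i.+1 h).
Proof.
have := @rule_2 c k 2 k_gt1; rewrite big_ltn // big_geq // msetD0 !copies_stack stackD.
by move/(@stack_move _ _ m j i h); rewrite !(addn0, addn1).
Qed.

Lemma move_raise2 m j i h : move (stack m (j + c.+1) i h) (stack m j i.+1 h).
Proof.
have := @rule_3b c k 2 k_gt1; rewrite !copies_stack => /(@stack_move _ _ m j i h).
by rewrite !(addn0, addn1).
Qed.

(** For k = 2, the number S_3 is S_(k+1), and the rule for c + 1 equal terms
    then also returns one copy of S_1. *)
Lemma move_raise3 m j i h :
  move (stack m j (i + c.+1) h) (stack (m + (k == 2)) j i h.+1).
Proof.
case: eqP => [k2|k_neq2].
  have := @rule_3c c k; rewrite k2 !copies_stack stackD.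
  by move/(@stack_move _ _ m j i h); rewrite !(addn0, addn1).
have k3 : 1 < 3 < k.+1 by lia.
have := rule_3b c k3; rewrite !copies_stack => /(@stack_move _ _ m j i h).
by rewrite !(addn0, addn1).
Qed.

(** For k = 2 the rule takes only c copies of S_1, not c + 1; the leftover copy
    is exactly the one that [move_raise3] returns. *)
Lemma move_merge123 m j i h :
  move (stack (m + c.+1) (j + c) (i + c) h) (stack (m + (k == 2)) j i h.+1).
Proof.
case: eqP => [k2|k_neq2].
  have k3 : k.+1 <= 3 by rewrite k2.
  have := rule_1 c k3; rewrite (_ : 3 - k = 1); last by rewrite k2.
  rewrite big_ltn // big_ltn // big_ltn // big_geq // msetD0 !copies_stack !stackD.
  move/(@stack_move _ _ m.+1 j i h).
  by rewrite !(addn0, addn1, add0n) addnS addSn.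
have k3 : 1 <= 3 <= k by lia.
have := rule_2 c k3; rewrite big_ltn // big_ltn // big_geq // msetD0.
rewrite !copies_stack !stackD.
by move/(@stack_move _ _ m j i h); rewrite !(addn0, addn1, add0n).
Qed.

(** Under these bounds, the moves with both S_2 and S_3 on their left side are
    unavailable, and so are those that need S_5 or c + 1 copies of S_4.  The
    bound on h admits h = 1, the case met after S_4 has been created. *)
Lemma move_cases m j i h q :
    h <= c -> (j < c) || (i < c) -> move (stack m j i h) q ->
  [\/ c < m /\ q = stack (m - c.+1) j.+1 i h,
      [/\ c < m, c <= j & q = stack (m - c.+1) (j - c) i.+1 h],
      c < j /\ q = stack m (j - c.+1) i.+1 h
    | c < i /\ q = stack (m + (k == 2)) j (i - c.+1) h.+1].
Proof.
move=> h_le few [l [r [lr /msubsetP sub ->]]].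
have {}sub y : l (nacci c k y) <= if y == 1 then m else if y == 2 then j
    else if y == 3 then i else if y == 4 then h else 0.
  by rewrite -(stackE m j i h y c_gt0 k_gt0).
case: l r / lr sub => [t le_t|t /andP[t_gt0 le_t]||t /andP[t_gt1 lt_t]||t lt_t] sub.
  (* This rule takes S_2 and S_3 whenever t <= 4, since t - k <= 2. *)
- have t_le4 : t <= 4.
    have := sub t; rewrite block_copiesE // leq_subr ltnSn /=.
    by case: t {le_t sub} => [|[|[|[|[|t]]]]] //=; lia.
  have := sub 2; have := sub 3; rewrite !block_copiesE //=.
  by rewrite !ifT; lia.
- case: t t_gt0 le_t sub => [//|[|[|t]]] _ le_t sub.
  + have := sub 1; rewrite big_geq // msetD0 copiesE //= => lt_m.
    constructor 1; split; [by []|clear sub].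
    by rewrite !copies_stack; apply: stack_replace; lia.
  + have := sub 2; have := sub 1; rewrite big_ltn // big_geq // msetD0.
    rewrite !msetE2 !copiesE //= addn0 => lt_m le_j.
    constructor 2; split; [by []|by []|clear sub].
    by rewrite copies_stack12 copies_stack; apply: stack_replace; lia.
  + have := sub 2; have := sub 3; rewrite !msetE2 !copiesE // !block_copiesE //=.
    lia.
- have := sub 1; rewrite copiesE //= => lt_m.
  constructor 1; split; [by []|clear sub].
  by rewrite !copies_stack; apply: stack_replace; lia.
- case: t t_gt1 lt_t sub => [//|[//|[|[|t]]]] _ lt_t sub.
  + have := sub 2; rewrite copiesE //= => lt_j.
    constructor 3; split; [by []|clear sub].
    by rewrite !copies_stack; apply: stack_replace; lia.
  + have := sub 3; rewrite copiesE //= => lt_i.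
    constructor 4; split; [by []|clear sub].
    by rewrite !copies_stack; apply: stack_replace; lia.
  + by have := sub t.+4; rewrite copiesE // eqxx; case: t {lt_t sub} => [|t] /=; lia.
- have := sub k.+1; rewrite copiesE // eqxx => sub_k.
  have k2 : k = 2 by move: sub_k; case: (k) k_gt1 => [|[|[|[|k']]]] //= _; lia.
  rewrite k2 /= in sub_k *.
  constructor 4; split; [by []|clear sub].
    by rewrite copies_stack41 copies_stack; apply: stack_replace; lia.
- have := sub t; rewrite copiesE // eqxx.
  by case: t lt_t {sub} => [|[|[|[|[|t]]]]] //= lt_t; lia.
Qed.

(** * Outcomes in the early game *)

(** With fewer than c copies of S_2 and at most c of S_3 the only move raises
    copies of S_1, so the outcome is carried along. *)
Lemma wins_raise1 X m j i h P :
    j < c -> i <= c -> h <= c ->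
  wins c k X (stack (m + c.+1) j i h) P ->
  wins c k X (stack m j.+1 i h) (opponent P).
Proof.
move=> lt_j le_i le_h; apply: wins_forced (move_raise1 m j i h) _ => q.
move=> mv; have few : (j < c) || (i < c) by rewrite lt_j.
case: (move_cases le_h few mv) => -[].
- by move=> _ ->; rewrite addnK.
- by move=> _; rewrite leqNgt lt_j.
- by rewrite ltnNge ltnW.
- by rewrite ltnNge le_i.
Qed.

Lemma wins_along_row X m j i P :
    j <= c -> i <= c ->
  wins c k X (stack (m + j * c.+1) 0 i 0) P ->
  wins c k X (stack m j i 0) (iter j opponent P).
Proof.
move=> + le_i; elim: j m => [|j IHj] m le_j; first by rewrite addn0.
by rewrite mulSn addnA => /(IHj _ (ltnW le_j)); apply: wins_raise1.
Qed.

(** The players who win at (c, i) and at (0, i + 1), when moving first, are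
    opposite: a winning move to (c + 1, i) is impossible, because its two
    options (0, i + 1) and (1, i + 1) are consecutive on a forced line and
    cannot both be won for the player to move. *)
Lemma wins_next_row X m i P :
    i < c ->
  wins c k X (stack (m + c.+1 + c.+1) c i 0) P ->
  wins c k X (stack (m + c.+1) 0 i.+1 0) (opponent P).
Proof.
move=> lt_i; have merge := move_merge12 (m + c.+1) 0 i 0.
case: (player_cases X P) => -> won; last first.
  by rewrite opponentK; apply: wins_waiting won _ merge.
have [q mv lost] := wins_to_move won.
case: (move_cases (leq0n c) _ mv); rewrite ?lt_i ?orbT // => -[].
- move=> _ def_q; rewrite {q mv}def_q addnK in lost.
  have next_won := wins_waiting lost (move_raise2 (m + c.+1) 0 i 0).
  have next1_won := wins_waiting lost (move_merge12 m 1 i 0).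
  by have /(wins_exclusive next1_won) := wins_raise1 c_gt0 lt_i (leq0n c) next_won.
- by move=> _ _ def_q; rewrite def_q addnK subnn in lost.
- lia.
- lia.
Qed.

(** Each row takes c forced moves and one flip to the next row.  The value of
    i copies of S_3 and c copies of S_2 is i (c + 1)^2 + c (c + 1). *)
Lemma wins_row_end X n m i P :
    i <= c -> c < m -> n = m + i * c.+1 ^ 2 + c * c.+1 ->
  wins c k X (stack n 0 0 0) P ->
  wins c k X (stack m c i 0) (iter (i * c.+1 + c) opponent P).
Proof.
move=> + + + start_won; elim: i m => [|i IHi] m le_i lt_m def_n.
  by apply: wins_along_row => //; rewrite addn0 in def_n; rewrite -def_n.
rewrite (_ : i.+1 * c.+1 + c = c + (i * c.+1 + c).+1); last by lia.
rewrite iterD iterS; apply: wins_along_row => //.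
rewrite (_ : m + c * c.+1 = m + c * c.+1 - c.+1 + c.+1); last by lia.
by apply: wins_next_row => //; apply: IHi; lia.
Qed.

(** The position with c copies each of S_2 and S_3 has the options E with
    c + 1 copies of S_3 and Z with one S_4.  If it were lost, E and Z would
    both be won for the player to move.  As Z is an option of E, the winning
    move at E is then to E', where an S_2 has been added, and Z is won only
    through Z', where likewise an S_2 has been added.  But E' and Z' are both
    lost for their mover, and E' has a move to Z'. *)
Lemma corner_not_lost X m :
  ~ wins c k X (stack (m + c.+1) c c 0) (opponent X).
Proof.
move=> lost.
have threes_won := wins_waiting lost (move_merge12 m 0 c 0).
have four_won := wins_waiting lost (move_merge123 m 0 0 0).
have [q mv q_lost] := wins_to_move threes_won.
case: (move_cases (leq0n c) _ mv); rewrite ?c_gt0 // => -[].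
- move=> lt_m def_q; rewrite {q mv}def_q in q_lost.
  have four_two_won := wins_waiting q_lost (move_raise3 (m - c.+1) 1 0 0).
  (* E' needs c + 1 copies of S_1 at E, so Z has at least as many left. *)
  rewrite (_ : m + _ = m - c.+1 + (k == 2) + c.+1) in four_won; last by lia.
  by have /(wins_exclusive four_two_won) := wins_raise1 c_gt0 (leq0n c) c_gt0 four_won.
- lia.
- lia.
- move=> _ def_q; rewrite {q mv}def_q subnn in q_lost.
  exact: wins_exclusive four_won q_lost.
Qed.

(** The position (c + 1, 0) has a move to (0, 1), so the two options of (c, 0)
    cannot both be lost for the player who faces them. *)
Lemma exists_mistake X m :
    wins c k X (stack (m + c.+1) c 0 0) X ->
  exists2 q, move (stack (m + c.+1) c 0 0) q
           & wins c k (opponent X) q (opponent X).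
Proof.
move=> won; have raise2 := move_raise2 m 0 0 0.
have [q mv q_lost] := wins_to_move won.
case: (move_cases (leq0n c) _ mv); rewrite ?c_gt0 ?orbT // => -[]; try lia.
- move=> _ def_q; rewrite {q mv}def_q addnK in q_lost.
  exists (stack m 0 1 0); first exact: move_merge12 m 0 0 0.
  exact: wins_swap (wins_waiting q_lost raise2).
- move=> _ _ def_q; rewrite {q mv}def_q addnK subnn in q_lost.
  exists (stack m c.+1 0 0); first exact: move_raise1.
  exact: wins_swap (wins_own raise2 q_lost).
Qed.

Lemma winner_takes_turn X n :
    c.+1 ^ 3 <= n -> wins c k X (start c k n) Player1 ->
  turn_player c.+1 = X.
Proof.
rewrite start_stack => n_ge won.
(* m + (c + 1) copies of S_1 remain at (c, c); this is where (c + 1)^3 <= n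
   is needed. *)
pose m := n - c * c.+1 ^ 2 - c * c.+1 - c.+1.
have corner : wins c k X (stack (m + c.+1) c c 0) (turn_player c.+1).
  rewrite turn_player_succ (_ : iter c _ _ = iter (c * c.+1 + c) opponent Player1).
    by apply: wins_row_end won => //; rewrite /m; lia.
  by rewrite !iter_opponent oddD oddM /= andbN.
case: (player_cases X (turn_player c.+1)) => // lost.
by rewrite lost in corner; case: (corner_not_lost corner).
Qed.
End Moves.

(** * The mistake at turn c + 1 *)

Unset Implicit Arguments.

(* The disjunction on n selects the n for which the claim is meaningful: turn
   c + 1 can be reached if and only if (c + 1)^2 <= n, and for some n below
   (c + 1)^3 that turn does not belong to the player who has a winning
   strategy.  From (c + 1)^3 on nothing is assumed.  In the conclusion, pos t
   is the position after turn t. *)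
Theorem theorem1p7 (c k n : nat) (hc : 1 <= c) (hk : 1 < k) (hn : 1 <= n)
    (X : player) (hX : wins c k X (start c k n) Player1)
    (hturn : (c + 1) ^ 3 <= n \/
             ((c + 1) ^ 2 <= n /\ turn_player (c + 1) = X)) :
  exists pos : nat -> position,
    [/\ pos 0 = start c k n,
        forall t : nat, 1 <= t <= c + 1 -> move c k (pos (t - 1)) (pos t),
        turn_player (c + 1) = X,
        wins c k X (pos c) X
      & wins c k (opponent X) (pos (c + 1)) (opponent X)].
Proof.
rewrite addn1 in hturn *.
have n_ge : c.+1 ^ 2 <= n.
  by case: hturn => [n_ge|[] //]; apply: leq_trans n_ge; rewrite leq_exp2l.
have turn_X : turn_player c.+1 = X.
  by case: hturn => [n_ge3|[] //]; apply: (winner_takes_turn hc hk n_ge3 hX).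
have before_won : wins c k X (stack c k (n - c * c.+1) c 0 0) X.
  rewrite -[in X in wins _ _ _ _ X]turn_X turn_player_succ.
  apply: wins_along_row => //; rewrite subnK -?start_stack //; lia.
have S1_left : c.+1 <= n - c * c.+1 by lia.
have [q mistake q_stolen] : exists2 q, move c k (stack c k (n - c * c.+1) c 0 0) q
    & wins c k (opponent X) q (opponent X).
  by rewrite -(subnK S1_left) in before_won *; apply: exists_mistake.
exists (fun t => if t <= c then stack c k (n - t * c.+1) t 0 0 else q).
split; rewrite ?leqnn ?ltnn //=; first by rewrite start_stack subn0.
case=> // t /andP[_ le_t]; rewrite subn1 /=.
rewrite -[t <= c]ltnS le_t; case: ltnP => [lt_t|le_c].
  rewrite (_ : n - t * c.+1 = n - t.+1 * c.+1 + c.+1); first exact: move_raise1.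
  by have := leq_mul lt_t (leqnn c.+1); lia.
by have -> : t = c by lia.
Qed.
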